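(* Let $R$ be a tolerance on a set $U$. The complete lattices $\wp(U)^{\blacktriangledown}$ and $\wp(U)^{\blacktriangle}$ are completely distributive if and only if $R$ is induced by an irredundant covering of $U$.
   Context: A tolerance on $U$ is a reflexive and symmetric binary relation $R$ on $U$; $R(x)=\{y\in U\mid x\,R\,y\}$. For $X\subseteq U$, $X^{\blacktriangledown}=\{x\in U\mid R(x)\subseteq X\}$ and $X^{\blacktriangle}=\{x\in U\mid R(x)\cap X\neq\emptyset\}$. $\wp(U)^{\blacktriangledown}=\{X^{\blacktriangledown}\mid X\subseteq U\}$ and $\wp(U)^{\blacktriangle}=\{X^{\blacktriangle}\mid X\subseteq U\}$ are ordered by inclusion and are complete lattices. A complete lattice $L$ is completely distributive if for any doubly indexed subset $\{x_{i,j}\}_{i\in I,\,j\in J}$ of $L$, $\bigwedge_{i\in I}\bigl(\bigvee_{j\in J}x_{i,j}\bigr)=\bigvee_{f\colon I\to J}\bigl(\bigwedge_{i\in I}x_{i,f(i)}\bigr)$. A covering of $U$ is a collection $\mathcal{H}$ of nonempty subsets of $U$ with $\bigcup\mathcal{H}=U$; it is irredundant if $\mathcal{H}\setminus\{X\}$ is not a covering of $U$ for any $X\in\mathcal{H}$. The tolerance induced by a covering $\mathcal{H}$ is $R_{\mathcal{H}}=\bigcup\{X\times X\mid X\in\mathcal{H}\}$. *)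

(* Defs.v *)
From HB Require Import structures.
From mathcomp Require Import all_boot all_order boolp classical_sets.

Set Implicit Arguments.
Unset Strict Implicit.
Unset Printing Implicit Defensive.

Local Open Scope classical_set_scope.

(* The members of a subset of a poset, with the restricted order. Since [set U]
   is ordered by inclusion, this orders every family of subsets of U by
   inclusion. *)
HB.instance Definition _ (d : Order.disp_t) (T : porderType d) (A : set T) :=
  [SubChoice_isSubPOrder of {x : T | x \in A} by <: with d].

Section CompleteLattice.
Context {d : Order.disp_t} {L : porderType d}.

Definition complete_lattice :=
  forall A : set L, supremums A !=set0 /\ infimums A !=set0.

Definition bigjoin (cL : complete_lattice) (A : set L) : L :=
  projT1 (cid (cL A).1).

Definition bigmeet (cL : complete_lattice) (A : set L) : L :=
  projT1 (cid (cL A).2).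

End CompleteLattice.

Arguments complete_lattice {d} L.

Definition completely_distributive {d : Order.disp_t} (L : porderType d) :=
  exists cL : complete_lattice L,
  forall (I J : Type) (x : I -> J -> L),
    bigmeet cL (range (fun i => bigjoin cL (range (fun j => x i j)))) =
    bigjoin cL (range (fun f : I -> J => bigmeet cL (range (fun i => x i (f i))))).

Section Tolerance.
Context {U : Type}.
Implicit Types (R : set (U * U)) (X : set U) (H : set (set U)).

Definition tolerance R :=
  (forall x, R (x, x)) /\ (forall x y, R (x, y) -> R (y, x)).

(* [xsection R x] is the set R(x) of all y such that x R y. *)
Definition lower_approx R X : set U := [set x | xsection R x `<=` X].

Definition upper_approx R X : set U := [set x | xsection R x `&` X !=set0].

Definition lower_approxs R : set (set U) := range (lower_approx R).

Definition upper_approxs R : set (set U) := range (upper_approx R).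

Definition covering H :=
  (forall X, H X -> X !=set0) /\ \bigcup_(X in H) X = setT.

Definition irredundant_covering H :=
  covering H /\ forall X, H X -> ~ covering (H `\ X).

Definition induced_tolerance H : set (U * U) := \bigcup_(X in H) (X `*` X).

End Tolerance.

(* Main.v *)
Require Import Defs.
From mathcomp Require Import all_boot all_order boolp classical_sets.

(** If [H] is an irredundant covering inducing [R], every block [X] of [H] has
    a point [p X] lying in no other block, so [R(p X) = X]. Both lattices are
    then isomorphic to the power set of [H] through [S |-> {X | p X \in S}],
    and power sets are completely distributive.

    Conversely, write [R(X)] for the upper approximation of [X]. For
    [z \in R(y)], complete distributivity of the upper approximations applied
    to [R(y)] and to the pairs [R(x)], [R(U \ R(x))] (whose joins are [U])
    yields a point [a] with [z \in R(a) <= R(y)] such that, for all [x],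
    [R(a) <= R(x)] or [R(a) <= R(U \ R(x))]. The second case is impossible for
    [x \in R(a)], so [R(a)] is a clique. The neighbourhoods that are cliques
    therefore induce [R], and they form an irredundant covering because a
    clique [R(b)] containing [a] equals [R(a)]. *)

Import Order.TTheory.
Local Open Scope classical_set_scope.

(** * Complete distributivity transported from a power set *)

Section PowersetIso.
Context {d : Order.disp_t} {L : porderType d} {T : Type}.
Variables (phi : L -> set T) (psi : set T -> L).
Hypothesis lePhi : forall x y, (x <= y)%O <-> phi x `<=` phi y.
Hypothesis psiK : cancel psi phi.

Lemma powerset_iso_inj : injective phi.
Proof.
by move=> x y e; apply/le_anti/andP; split; apply/lePhi; rewrite e.
Qed.

Lemma powerset_iso_complete : complete_lattice L.
Proof.
move=> A; split.
  exists (psi (\bigcup_(x in A) phi x)); split.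
    by move=> x Ax; apply/lePhi; rewrite psiK; exact: bigcup_sup.
  move=> y yA; apply/lePhi; rewrite psiK.
  by apply: bigcup_sub => x /yA /lePhi.
exists (psi (\bigcap_(x in A) phi x)); split.
  by move=> x Ax; apply/lePhi; rewrite psiK; exact: bigcap_inf.
move=> y yA; apply/lePhi; rewrite psiK.
by apply: sub_bigcap => x /yA /lePhi.
Qed.

Lemma powerset_iso_bigjoin (cL : complete_lattice L) (A : set L) :
  phi (bigjoin cL A) = \bigcup_(x in A) phi x.
Proof.
rewrite /bigjoin; case: cid => s /= [ubs lbs]; apply/seteqP; split; last first.
  by apply: bigcup_sub => x /ubs /lePhi.
rewrite -[X in _ `<=` X]psiK; apply/lePhi/lbs => x Ax.
by apply/lePhi; rewrite psiK; exact: bigcup_sup.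
Qed.

Lemma powerset_iso_bigmeet (cL : complete_lattice L) (A : set L) :
  phi (bigmeet cL A) = \bigcap_(x in A) phi x.
Proof.
rewrite /bigmeet; case: cid => s /= [lbs ubs]; apply/seteqP; split.
  by apply: sub_bigcap => x /lbs /lePhi.
rewrite -[X in X `<=` _]psiK; apply/lePhi/ubs => x Ax.
by apply/lePhi; rewrite psiK; exact: bigcap_inf.
Qed.

(** [phi] turns meets and joins into intersections and unions, for which the law amounts to choosing
    one [j] for each [i]. *)
Lemma powerset_iso_completely_distributive : completely_distributive L.
Proof.
exists powerset_iso_complete => I J x; apply: powerset_iso_inj.
rewrite powerset_iso_bigmeet powerset_iso_bigjoin; apply/seteqP; split => t.
  move=> xt.
  have /choice[f ft] i : exists j, phi (x i j) t.
    have /xt : range (fun i => bigjoin powerset_iso_complete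
      (range (fun j => x i j))) (bigjoin powerset_iso_complete
      (range (fun j => x i j))) by exists i.
    by rewrite powerset_iso_bigjoin => -[_ [j _ <-]]; exists j.
  exists (bigmeet powerset_iso_complete (range (fun i => x i (f i)))).
    by exists f.
  by rewrite powerset_iso_bigmeet => _ [i _ <-].
move=> [_ [f _ <-]]; rewrite powerset_iso_bigmeet => ft _ [i _ <-].
rewrite powerset_iso_bigjoin; exists (x i (f i)); first by exists (f i).
by apply: ft; exists i.
Qed.

End PowersetIso.

(** * Approximations and private points of blocks *)

Section Approximations.
Context {U : Type}.
Implicit Types (R : set (U * U)) (X : set U) (H : set (set U)).

Lemma le_set_type H (S T : set_type H) : (S <= T)%O <-> \val S `<=` \val T.
Proof. by rewrite -Order.le_val subsetEset. Qed.

Lemma upper_approxP R X u :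
  upper_approx R X u <-> exists2 v, R (u, v) & X v.
Proof.
by split=> [[v [/xsectionP Ruv Xv]]|[v Ruv Xv]]; exists v => //; split=> //;
  apply/xsectionP.
Qed.

Lemma lower_approxP R X u : lower_approx R X u <-> forall v, R (u, v) -> X v.
Proof.
by split=> [uX v Ruv|uX v /xsectionP /uX //]; apply/uX/xsectionP.
Qed.

Definition upper R X : set_type (upper_approxs R) :=
  SigSub (mem_set (imageT (upper_approx R) X)).

Definition lower R X : set_type (lower_approxs R) :=
  SigSub (mem_set (imageT (lower_approx R) X)).

(** If every point of [X] lay in a further block, the blocks other than [X] would still cover. *)
Lemma irredundant_private_point H X : irredundant_covering H -> H X ->
  exists2 a, X a & forall Y, H Y -> Y a -> Y = X.
Proof.
move=> [[H0 HU] Hirr] HX; apply: contrapT => noa; apply: (Hirr X HX); split.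
  by move=> Y [/H0].
apply/seteqP; split=> // u _.
have [Y HY Yu] : (\bigcup_(X in H) X) u by rewrite HU.
have [YX|YX] := pselect (Y = X); last by exists Y.
apply: contrapT => nou; apply: noa; exists u; first by rewrite -YX.
move=> Z HZ Zu; apply: contrapT => ZX; apply: nou.
by exists Z.
Qed.

End Approximations.

(** * Approximations determined by the private points they contain *)

Section IrredundantCovering.
Context {U : Type} {H : set (set U)} (p : {X | H X} -> U).
Hypothesis p_mem : forall t, sval t (p t).
Hypothesis p_private : forall t Y, H Y -> Y (p t) -> Y = sval t.

Let R := induced_tolerance H.

Lemma induced_toleranceP u v :
  R (u, v) <-> exists t : {X | H X}, sval t u /\ sval t v.
Proof.
by split=> [[X HX] [Xu Xv]|[[X HX] Xuv]]; [exists (exist _ X HX)|exists X].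
Qed.

Lemma private_point_toleranceP t u : R (p t, u) <-> sval t u.
Proof.
rewrite induced_toleranceP; split=> [[s [sp su]]|tu]; last by exists t.
by rewrite -(p_private t _ (proj2_sig s) sp).
Qed.

(** A neighbour [v] of [u] in [Y] shares a block [t] with [u]. Since [p t] is related to all of [t],
    the same [v] puts [p t] into the approximation. *)
Lemma upper_approx_private_pointsP X u : upper_approxs R X ->
  X u <-> exists2 t, sval t u & X (p t).
Proof.
move=> [Y _ <-]; split.
  move=> /upper_approxP[v /induced_toleranceP[t [tu tv]] Yv]; exists t => //.
  by apply/upper_approxP; exists v => //; apply/private_point_toleranceP.
move=> [t tu /upper_approxP[v /private_point_toleranceP tv Yv]].
by apply/upper_approxP; exists v => //; apply/induced_toleranceP; exists t.
Qed.

(** The neighbourhood of [u] is the union of the blocks [t] containing [u], and each of them is the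
    neighbourhood of [p t]. *)
Lemma lower_approx_private_pointsP X u : lower_approxs R X ->
  X u <-> forall t, sval t u -> X (p t).
Proof.
move=> [Y _ <-]; split.
  move=> /lower_approxP uY t tu; apply/lower_approxP => v.
  move=> /private_point_toleranceP tv.
  by apply/uY/induced_toleranceP; exists t.
move=> up; apply/lower_approxP => v /induced_toleranceP[t [tu tv]].
by have /lower_approxP := up t tu; apply; apply/private_point_toleranceP.
Qed.

Lemma upper_approxs_completely_distributive :
  completely_distributive (set_type (upper_approxs R)).
Proof.
apply: (powerset_iso_completely_distributive (fun S => p @^-1` \val S)
  (fun G => upper R (p @` G))).
  move=> S T; rewrite le_set_type; split=> [ST t /ST //|ST u].
  move=> /(upper_approx_private_pointsP _ _ (set_mem (valP S)))[t tu St].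
  by apply/(upper_approx_private_pointsP _ _ (set_mem (valP T))); exists t => //;
    exact: ST.
move=> G; apply/seteqP; split=> t.
  move=> /upper_approxP[v /private_point_toleranceP tv [s Gs sv]].
  suff -> : t = s by [].
  (* As [v] is [p s], the block [t] contains the private point of [s]. *)
  have := p_private s _ (proj2_sig t) _; rewrite sv => /(_ tv).
  by case: (t) (s) => [X HX] [Y HY] /= e; exact: eq_exist.
move=> Gt; apply/upper_approxP; exists (p t); last by exists t.
exact/private_point_toleranceP.
Qed.

Lemma lower_approxs_completely_distributive :
  completely_distributive (set_type (lower_approxs R)).
Proof.
apply: (powerset_iso_completely_distributive (fun S => p @^-1` \val S)
  (fun G => lower R (\bigcup_(t in G) sval t))).
  move=> S T; rewrite le_set_type; split=> [ST t /ST //|ST u].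
  move=> /(lower_approx_private_pointsP _ _ (set_mem (valP S))) uS.
  apply/(lower_approx_private_pointsP _ _ (set_mem (valP T))) => t /uS.
  exact: ST.
move=> G; apply/seteqP; split=> t.
  (* [p t] is its own neighbour, so it lies in some block of [G], which can only be [t]. *)
  move=> /lower_approxP tG.
  have [|s Gs sp] := tG (p t); first exact/private_point_toleranceP.
  suff -> : t = s by [].
  have := p_private t _ (proj2_sig s) sp.
  by case: (t) (s) Gs sp => [X HX] [Y HY] _ _ /= e; exact: eq_exist.
move=> Gt; apply/lower_approxP => v /private_point_toleranceP tv.
by exists t.
Qed.

End IrredundantCovering.

(** * Cliques obtained from complete distributivity *)

Section Cliques.
Context {U : Type} (R : set (U * U)).
Hypothesis hR : tolerance R.

Definition clique_center a := forall u v, R (a, u) -> R (a, v) -> R (u, v).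

Lemma clique_center_exists y z :
  completely_distributive (set_type (upper_approxs R)) -> R (y, z) ->
  exists a, [/\ clique_center a, R (a, y) & R (a, z)].
Proof.
have [Rxx Rsym] := hR.
move=> [cL cd] Ryz.
pose nbhd x := upper R [set x].
(* The index [None] carries a constant family, so that every choice function keeps its meet inside
   [nbhd y]. *)
pose x (i : option U) (b : bool) :=
  if i is Some x then
    if b then nbhd x else upper R [set u | ~ R (x, u)]
  else nbhd y.
have nbhdP u v : \val (nbhd u) v <-> R (u, v).
  rewrite /= upper_approxP; split=> [[w /Rsym Rwv <-] //|/Rsym Rvu].
  by exists u.
have joinT i b : \val (x i b) `<=` \val (bigjoin cL (range (x i))).
  rewrite /bigjoin; case: cid => s /= [ubs _]; apply/le_set_type/ubs.
  by exists b.
have : \val (bigmeet cL (range (fun i => bigjoin cL (range (x i))))) z.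
  rewrite /bigmeet; case: cid => m /= [_ ubm].
  have /ubm/le_set_type : lbound (range (fun i => bigjoin cL (range (x i))))
      (nbhd y).
    move=> _ [[w|] _ <-]; apply/le_set_type; last exact: (joinT None true).
    (* Either [R(u)] is included in [R(w)], which then contains [u] by reflexivity, or [u] has a
       neighbour outside [R(w)]. *)
    move=> u _; have [wu|] := pselect (forall v, R (u, v) -> R (w, v)).
      by apply: (joinT (Some w) true); apply/nbhdP/wu.
    move=> /existsNP[v /not_implyP[Ruv nRwv]].
    by apply: (joinT (Some w) false); apply/upper_approxP; exists v.
  by apply; apply/nbhdP.
rewrite (cd _ _ x).
pose m f := bigmeet cL (range (fun i => x i (f i))).
rewrite -/m.
have mx f i : \val (m f) `<=` \val (x i (f i)).
  rewrite /m /bigmeet; case: cid => s /= [lbs _]; apply/le_set_type/lbs.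
  by exists i.
(* The join of the [m f] is their union, and any element of an upper
   approximation [S] lies in some [R(a) <= S]. *)
have joinU : \val (bigjoin cL (range m)) `<=`
    upper_approx R [set a | exists f, forall u, R (a, u) -> \val (m f) u].
  rewrite /bigjoin; case: cid => s /= [_ lbs].
  (* The right-hand side is itself an upper approximation, so it bounds the join once it bounds each
     [m f]. *)
  apply/(le_set_type _ _ (upper R _))/lbs => _ [f _ <-]; apply/le_set_type.
  have [Y _ mY] := set_mem (valP (m f)).
  move=> u; rewrite -mY => /upper_approxP[w Ruw Yw]; apply/upper_approxP.
  exists w => //; exists f => v Rwv; rewrite -mY; apply/upper_approxP.
  by exists w => //; exact: Rsym.
move=> /joinU/upper_approxP[a /Rsym Raz [f am]]; exists a; split=> //.
  move=> u v Rau Rav.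
  have := mx f (Some u); rewrite /x; case: (f _) => mu.
    by apply/nbhdP/mu/am.
  (* Here [u] would have a neighbour outside [R(u)]. *)
  have /mu/upper_approxP[w Ruw nRuw] := am _ Rau.
  by case: nRuw.
by apply: Rsym; apply/nbhdP/(mx f None)/am.
Qed.

Lemma clique_center_sub a b : clique_center b -> R (b, a) ->
  xsection R b `<=` xsection R a.
Proof. by move=> cb Rba u /xsectionP Rbu; apply/xsectionP/cb. Qed.

Lemma irredundant_covering_cliques :
  (forall y, exists2 a, clique_center a & R (a, y)) ->
  irredundant_covering (xsection R @` clique_center).
Proof.
have [Rxx Rsym] := hR.
move=> cover; split.
  split; first by move=> _ [a _ <-]; exists a; apply/xsectionP.
  apply/seteqP; split=> // y _; have [a ca Ray] := cover y.
  by exists (xsection R a); [exists a|apply/xsectionP].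
move=> _ [a ca <-] [_ Hcov].
(* The point left uncovered when [R(a)] is removed is [a] itself. *)
have [_ [[b cb <-] ba] /xsectionP Rba] :
  (\bigcup_(X in (xsection R @` clique_center) `\ xsection R a) X) a.
  by rewrite Hcov.
by apply: ba; apply/seteqP; split; apply: clique_center_sub => //; exact: Rsym.
Qed.

Lemma induced_tolerance_cliques :
  (forall y z, R (y, z) -> exists a, [/\ clique_center a, R (a, y) & R (a, z)]) ->
  R = induced_tolerance (xsection R @` clique_center).
Proof.
move=> cover; apply/seteqP; split=> [[y z] /cover[a [ca Ray Raz]]|[y z]].
  by exists (xsection R a); [exists a|split; apply/xsectionP].
by move=> [_ [a ca <-] [/xsectionP Ray /xsectionP Raz]]; exact: ca.
Qed.

End Cliques.

Theorem proposition3p5 (U : Type) (R : set (U * U)) (hR : tolerance R) :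
  (completely_distributive (set_type (lower_approxs R)) /\
   completely_distributive (set_type (upper_approxs R))) <->
  (exists H : set (set U), irredundant_covering H /\ R = induced_tolerance H).
Proof.
split=> [[_ cd]|[H [Hirr ->]]].
  exists (xsection R @` clique_center R); split.
    apply: irredundant_covering_cliques => // y.
    by have [a [ca Ray _]] := clique_center_exists R hR y y cd (hR.1 y); exists a.
  by apply: induced_tolerance_cliques => y z; exact: clique_center_exists.
have /choice[p pP] (t : {X | H X}) : exists a, sval t a /\
    forall Y, H Y -> Y a -> Y = sval t.
  by have [a ta aP] := irredundant_private_point _ _ Hirr (proj2_sig t); exists a.
split; [apply: (lower_approxs_completely_distributive p)
       |apply: (upper_approxs_completely_distributive p)];
  by move=> t; case: (pP t).
Qed.
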